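(* Let $d,n\in\mathbb{N}$ and let $\hat w_{\boldsymbol{k}}\in\mathbb{R}$, $\boldsymbol{k}\in\mathbb{Z}^d$, be weights with $\sum_{\boldsymbol{k}\in\mathbb{Z}^d}|\hat w_{\boldsymbol{k}}|<\infty$. Let $K(\boldsymbol{x})=\sum_{\boldsymbol{k}\in\mathbb{Z}^d}\hat w_{\boldsymbol{k}}e^{2\pi i\boldsymbol{k}\cdot\boldsymbol{x}}$ and $$\boldsymbol{K}=\left(K\left(\tfrac{\boldsymbol{j}-\boldsymbol{l}}{n}\right)\right)_{\boldsymbol{j},\boldsymbol{l}\in I_n}\in\mathbb{C}^{n^d\times n^d}.$$ Then: (i) The eigenvalues of $\boldsymbol{K}$ are given by $$\lambda_{\boldsymbol{s}}(\boldsymbol{K})=n^d\sum_{\boldsymbol{r}\in\mathbb{Z}^d}\hat w_{\boldsymbol{s}+n\boldsymbol{r}},\qquad\boldsymbol{s}\in I_n.$$ (ii) For tensor product weights $\hat w_{\boldsymbol{k}}=\prod_{t=0}^{d-1}\hat w_{k_t}$, where $(\hat w_k)_{k\in\mathbb{Z}}$ is a univariate real sequence with $\sum_{k\in\mathbb{Z}}|\hat w_k|<\infty$, this simplifies to $$\lambda_{\boldsymbol{s}}(\boldsymbol{K})=n^d\prod_{t=0}^{d-1}\sum_{r_t\in\mathbb{Z}}\hat w_{s_t+nr_t},\qquad\boldsymbol{s}\in I_n.$$ (iii) For any $\Gamma\subset I_n$, the extremal eigenvalues of $$\boldsymbol{K}_\Gamma=\left(K\left(\tfrac{\boldsymbol{j}-\boldsymbol{l}}{n}\right)\right)_{\boldsymbol{j},\boldsymbol{l}\in\Gamma}$$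 are bounded by the extremal eigenvalues of $\boldsymbol{K}$, i.e. the smallest eigenvalue of $\boldsymbol{K}_\Gamma$ is at least the smallest eigenvalue of $\boldsymbol{K}$ and the largest eigenvalue of $\boldsymbol{K}_\Gamma$ is at most the largest eigenvalue of $\boldsymbol{K}$.
   Context: $I_n$ is the set of integer vectors with all components in $[-\frac n2,\frac n2)$; for even $n$ this is $\{-\frac n2,\dots,\frac n2-1\}^d$. It has $n^d$ elements and is a complete residue system of $\mathbb{Z}^d$ modulo $n$. Eigenvalues are listed with multiplicity, indexed by $\boldsymbol{s}\in I_n$. In (iii), $\Gamma$ is nonempty. Since the weights are real, $\boldsymbol{K}$ and $\boldsymbol{K}_\Gamma$ are Hermitian. *)

(* Defs.v *)
From HB Require Import structures.
From mathcomp Require Import all_boot all_order all_algebra finmap.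
From mathcomp Require Import all_classical all_reals all_analysis.
From mathcomp Require Import complex zify.

Set Implicit Arguments.
Unset Strict Implicit.
Unset Printing Implicit Defensive.

Import Order.TTheory GRing.Theory Num.Theory.

Local Open Scope classical_set_scope.
Local Open Scope ring_scope.
Local Open Scope complex_scope.

(* Unordered sum over the whole of T.  The library's \esum is a supremum over
   finite subsets, meant for nonnegative terms, so the positive and negative
   parts are summed separately; the value is meaningful for families that are
   [summable]. *)
Definition rsum (R : realType) (T : choiceType) (f : T -> R) : R :=
  fine (\esum_(t in [set: T]) (Num.max (f t) 0)%:E)
  - fine (\esum_(t in [set: T]) (Num.max (- f t) 0)%:E).

Definition csum (R : realType) (T : choiceType) (f : T -> R[i]) : R[i] :=
  rsum (fun t => complex.Re (f t)) +i* rsum (fun t => complex.Im (f t)).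

Definition expi (R : realType) (u : R) : R[i] := cos u +i* sin u.

Definition idot (R : realType) (d : nat) (k : 'rV[int]_d) (x : 'rV[R]_d) : R :=
  \sum_(t < d) (k 0 t)%:~R * x 0 t.

Definition kernel (R : realType) (d : nat) (w : 'rV[int]_d -> R)
    (x : 'rV[R]_d) : R[i] :=
  csum (fun k : 'rV[int]_d => (w k)%:C * expi (2 * pi * idot k x)).

Definition grid_point (R : realType) (d n : nat) (j : 'rV[int]_d) : 'rV[R]_d :=
  \row_t ((j 0 t)%:~R / n%:R).

Definition index_box (d n : nat) : {fset 'rV[int]_d} :=
  fset_set [set s : 'rV[int]_d |
            forall t, - n%:Z <= s 0 t *+ 2 /\ s 0 t *+ 2 < n%:Z].

(* [fset_set] returns fset0 on infinite sets; this is not the case here. *)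
Lemma index_box_finite (d n : nat) :
  finite_set [set s : 'rV[int]_d |
              forall t, - n%:Z <= s 0 t *+ 2 /\ s 0 t *+ 2 < n%:Z].
Proof.
pose g (f : {ffun 'I_d -> 'I_n.*2.+1}) : 'rV[int]_d :=
  \row_t ((f t : nat)%:Z - n%:Z).
apply: (@sub_finite_set _ _ (g @` [set: {ffun 'I_d -> 'I_n.*2.+1}])); last first.
  exact/finite_image/finite_finset.
move=> s /= hs; exists [ffun t : 'I_d => inord `|(s 0 t + n%:Z)%R|%N] => //.
apply/rowP => t; rewrite mxE ffunE.
have [] := hs t; move: (s 0 t) => z h1 h2.
have hz : 0 <= z + n%:Z by lia.
by rewrite inordK; lia.
Qed.

Lemma mem_index_box (d n : nat) (s : 'rV[int]_d) :
  reflect (forall t, - n%:Z <= s 0 t *+ 2 /\ s 0 t *+ 2 < n%:Z)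
          (s \in index_box d n).
Proof.
by apply: (iffP idP); rewrite in_fset_set ?inE //; exact: index_box_finite.
Qed.

(* Rows and columns are indexed by an enumeration of G. *)
Definition kernel_mx (R : realType) (d n : nat) (w : 'rV[int]_d -> R)
    (G : {fset 'rV[int]_d}) : 'M[R[i]]_(#|{: G}|) :=
  \matrix_(p, q)
    kernel w (grid_point R n (val (enum_val p) - val (enum_val q))).

(* The entries of l are the eigenvalues of A, repeated according to both
   algebraic and geometric multiplicity (these agree for Hermitian A). *)
Definition eigenvalues_listed (F : fieldType) (m : nat) (A : 'M[F]_m)
    (l : seq F) : Prop :=
  char_poly A = \prod_(a <- l) ('X - a%:P)
  /\ forall a : F, \rank (eigenspace A a) = count_mem a l.

(* The order on R[i] only compares numbers with equal imaginary part, so these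
   predicates also say that all eigenvalues of A are real. *)
Definition smallest_eigenvalue (R : realType) (m : nat) (A : 'M[R[i]]_m)
    (a : R) : Prop :=
  eigenvalue A a%:C /\ forall b : R[i], eigenvalue A b -> a%:C <= b.

Definition largest_eigenvalue (R : realType) (m : nat) (A : 'M[R[i]]_m)
    (a : R) : Prop :=
  eigenvalue A a%:C /\ forall b : R[i], eigenvalue A b -> b <= a%:C.

(* Main.v *)
Require Import Defs.
From mathcomp Require Import all_boot all_order all_algebra finmap.
From mathcomp Require Import all_classical all_reals all_analysis.
From mathcomp Require Import complex.
From mathcomp Require Import zify lra ring.

(** The kernel matrix is diagonalized by the discrete Fourier vectors.

    On the grid of integer points divided by n, the characters with
    frequencies s and s + n r coincide.  Grouping the absolutely summable
    series K by residue classes modulo n, with the box as a system of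
    representatives, therefore turns K on the grid into a finite
    trigonometric sum whose coefficients are the aliased weights
    mu_s = sum_r w_(s + n r)  ([kernel_grid]).  Hence, for every subset G of
    the box, the kernel matrix over G factors as F_G D F_G^*, where D is the
    diagonal matrix of the mu_s and the rows of F_G are the characters at the
    points of G ([kernel_mx_factorization]).  Orthogonality of the characters
    over the box gives F_G F_G^* = n^d I ([fourier_mx_rows_orthogonal]).

    When G is the whole box, F_G is square, F_G^* is a multiple of its
    inverse, and the kernel matrix is similar to n^d D; this yields the list
    of eigenvalues with both multiplicities ([kernel_mx_eigenvalues]).  For
    tensor product weights, mu_s is a sum over Z^d of a product of functions
    of one coordinate each, which is the product of the coordinate sums
    ([has_sum_row]).

    For general G, let v be an eigenvector over G with eigenvalue z, and put
    u = v F_G.  Then z |v|^2 = sum_s mu_s |u_s|^2 and |u|^2 = n^d |v|^2, so z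
    is a weighted average of the numbers n^d mu_s, that is, of eigenvalues
    over the whole box.  So z is real and lies between the extreme ones
    ([kernel_mx_eigenvalue_bounds]). *)

Set Implicit Arguments.
Unset Strict Implicit.
Unset Printing Implicit Defensive.

Import Order.TTheory GRing.Theory Num.Theory.

Local Open Scope classical_set_scope.
Local Open Scope ring_scope.
Local Open Scope complex_scope.

(** * Sums of nonnegative families *)

Section NonnegativeSums.
Variable R : realType.

Definition nonneg_sum (T : choiceType) (p : T -> R) (P : R) : Prop :=
  (forall t, 0 <= p t) /\ \esum_(t in [set: T]) (p t)%:E = P%:E.

Lemma nonneg_sumD (T : choiceType) (p q : T -> R) (P Q : R) :
  nonneg_sum p P -> nonneg_sum q Q ->
  nonneg_sum (fun t => p t + q t) (P + Q).
Proof.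
move=> [p0 pP] [q0 qQ]; split; first by move=> t; rewrite addr_ge0.
rewrite EFinD -pP -qQ -esumD; first exact: eq_esum.
- by move=> t _; rewrite lee_fin.
- by move=> t _; rewrite lee_fin.
Qed.

Lemma nonneg_sum_nested (T1 T2 : choiceType) (p : T1 -> T2 -> R)
    (P : T1 -> R) (S : R) :
  (forall i, nonneg_sum (p i) (P i)) -> nonneg_sum P S ->
  nonneg_sum (fun k : T1 * T2 => p k.1 k.2) S.
Proof.
move=> pP [_ PS]; split; first by move=> k; case: (pP k.1).
rewrite -PS (_ : [set: T1 * T2] = [set: T1] `*`` (fun=> [set: T2])).
  rewrite -(esum_esum (a := fun i j => (p i j)%:E)).
    by apply: eq_esum => i _; case: (pP i).
  by move=> i j _ _; rewrite lee_fin; case: (pP i).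
by apply/seteqP; split.
Qed.

Lemma nonneg_sumZ (T : choiceType) (c : R) (p : T -> R) (P : R) :
  0 <= c -> nonneg_sum p P -> nonneg_sum (fun t => c * p t) (c * P).
Proof.
move=> c0 [p0 pP]; split; first by move=> t; rewrite mulr_ge0.
rewrite EFinM -pP /esum -ereal_supZl //; last first.
  by apply/set0P; eexists; exists set0; [exact: fsets_set0|].
congr ereal_sup; apply/seteqP.
split=> [x [A fA <-]|x [_ [A fA <-] <-]].
  exists (\sum_(t \in A) (p t)%:E)%E; first by exists A.
  case: fA => finA _.
  by rewrite !fsbig_finite //= ge0_sume_distrr// => t _; rewrite lee_fin.
exists A => //; case: fA => finA _.
by rewrite !fsbig_finite //= ge0_sume_distrr// => t _; rewrite lee_fin.
Qed.

(** The inner sums are p i * Q, so this is Tonelli for a product. *)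
Lemma nonneg_sum_prod (T1 T2 : choiceType) (p : T1 -> R) (q : T2 -> R)
    (P Q : R) :
  nonneg_sum p P -> nonneg_sum q Q ->
  nonneg_sum (fun k : T1 * T2 => p k.1 * q k.2) (P * Q).
Proof.
move=> pP qQ; have Q0 : 0 <= Q.
  rewrite -lee_fin; case: qQ => q0 <-.
  by apply: esum_ge0 => t _; rewrite lee_fin.
apply: (@nonneg_sum_nested _ _ (fun i j => p i * q j) (fun i => p i * Q)).
  by move=> i; apply: nonneg_sumZ => //; case: pP.
have [p0' pS] := nonneg_sumZ Q0 pP.
split; first by move=> t; rewrite mulrC.
by rewrite mulrC -pS; apply: eq_esum => t _; rewrite mulrC.
Qed.

Lemma nonneg_sum_fin (I : finType) (p : I -> R) :
  (forall i, 0 <= p i) -> nonneg_sum p (\sum_i p i).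
Proof.
move=> p0; split=> //; rewrite esum_fset; last first.
- by move=> t _; rewrite lee_fin.
- exact: finite_finset.
rewrite (fsbigE (index_enum I)) ?index_enum_uniq //; last first.
  by move=> i _; rewrite mem_index_enum.
by rewrite -sumEFin; apply: eq_bigl => i; apply: mem_set.
Qed.

Lemma nonneg_sum_bij (T T' : choiceType) (e : T -> T') (p : T' -> R) (P : R) :
  bijective e -> nonneg_sum p P -> nonneg_sum (p \o e) P.
Proof.
rewrite -setTT_bijective => ebij [p0 pP]; split=> [t|]; first exact: p0.
by rewrite -pP (reindex_esum [set: T] [set: T'] e).
Qed.

End NonnegativeSums.

(** * Unordered sums of signed families *)

Section SignedSums.
Variable R : realType.

(** [rsum] splits a family into its positive and negative parts, and these do
    not behave well under sums and products.  Allowing an arbitrary difference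
    of two summable nonnegative families gives a relation that does, and
    [has_sum_rsum] shows that it still determines the value of [rsum]. *)
Definition has_sum (T : choiceType) (f : T -> R) (S : R) : Prop :=
  exists p q P Q, [/\ nonneg_sum p P, nonneg_sum q Q,
    (forall t, f t = p t - q t) & S = P - Q].

Lemma nonneg_summable (T : choiceType) (p : T -> R) (P : R) :
  nonneg_sum p P -> summable [set: T] (EFin \o p).
Proof.
move=> [p0 pP]; rewrite /summable (_ : esum _ _ = P%:E) ?ltry //.
by rewrite -pP; apply: eq_esum => t _; rewrite /= ger0_norm.
Qed.

Lemma summable_nonneg (T : choiceType) (f : T -> R) (p : T -> R) :
  summable [set: T] (fun t => (f t)%:E) ->
  (forall t, 0 <= p t <= `|f t|) ->
  nonneg_sum p (fine (\esum_(t in [set: T]) (p t)%:E)).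
Proof.
move=> fS pf; split; first by move=> t; case/andP: (pf t).
rewrite fineK // ge0_fin_numE; last first.
  by apply: esum_ge0 => t _; rewrite lee_fin; case/andP: (pf t).
apply: le_lt_trans fS; apply: le_esum => t _.
by rewrite /= lee_fin; case/andP: (pf t).
Qed.

Lemma summable_pos_part (T : choiceType) (f : T -> R) :
  summable [set: T] (fun t => (f t)%:E) ->
  nonneg_sum (fun t => Num.max (f t) 0)
    (fine (\esum_(t in [set: T]) (Num.max (f t) 0)%:E)).
Proof.
move=> fS; apply: (summable_nonneg fS) => t.
by rewrite le_max lexx orbT /= ge_max ler_norm normr_ge0.
Qed.

Lemma summable_neg_part (T : choiceType) (f : T -> R) :
  summable [set: T] (fun t => (f t)%:E) ->
  nonneg_sum (fun t => Num.max (- f t) 0)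
    (fine (\esum_(t in [set: T]) (Num.max (- f t) 0)%:E)).
Proof.
move=> fS; apply: (summable_nonneg fS) => t.
by rewrite le_max lexx orbT /= ge_max -normrN ler_norm normr_ge0.
Qed.

Lemma summable_has_sum (T : choiceType) (f : T -> R) :
  summable [set: T] (fun t => (f t)%:E) -> has_sum f (rsum f).
Proof.
move=> fS.
exists (fun t => Num.max (f t) 0), (fun t => Num.max (- f t) 0).
do 2!eexists; split=> //; [exact: summable_pos_part|exact: summable_neg_part|].
move=> t; case: (leP 0 (f t)) => ft.
  by rewrite max_r ?subr0 // oppr_le0.
by rewrite max_l ?opprK ?add0r // oppr_ge0 ltW.
Qed.

(** If f = p - q with p and q nonnegative, then f^+ + q = f^- + p, and adding
    up both sides shows that the value does not depend on the decomposition. *)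
Lemma has_sum_rsum (T : choiceType) (f : T -> R) (S : R) :
  has_sum f S -> rsum f = S.
Proof.
move=> [p [q [P [Q [pP qQ fE ->]]]]].
have pS := nonneg_summable pP; have qS := nonneg_summable qQ.
have fS : summable [set: T] (fun t => (f t)%:E).
  rewrite (_ : (fun t => _) = (EFin \o p \- (EFin \o q))%E).
    exact: summableB.
  by apply/funext => t; rewrite fE.
have [_ posE] := summable_pos_part fS; have [_ negE] := summable_neg_part fS.
have := esumB pS qS (fun t _ => proj1 pP t) (fun t _ => proj1 qQ t).
have -> : (EFin \o p \- (EFin \o q))%E^\+%E
    = (fun t => (Num.max (f t) 0)%:E).
  by apply/funext => t; rewrite funeposE /= fE EFin_max.
have -> : (EFin \o p \- (EFin \o q))%E^\-%E
    = (fun t => (Num.max (- f t) 0)%:E).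
  by apply/funext => t; rewrite funenegE /= fE EFin_max.
rewrite posE negE /= (proj2 pP) (proj2 qQ).
by case.
Qed.

Lemma has_sum_bij (T T' : choiceType) (e : T -> T') (f : T' -> R) (S : R) :
  bijective e -> has_sum f S -> has_sum (f \o e) S.
Proof.
move=> be [p [q [P [Q [pP qQ fE ->]]]]].
exists (p \o e), (q \o e), P, Q; split=> //; try exact: nonneg_sum_bij.
by move=> t; exact: fE.
Qed.

Lemma has_sumZ (T : choiceType) (c : R) (f : T -> R) (S : R) :
  has_sum f S -> has_sum (fun t => c * f t) (c * S).
Proof.
move=> [p [q [P [Q [pP qQ fE ->]]]]].
case: (leP 0 c) => c0.
  exists (fun t => c * p t), (fun t => c * q t), (c * P), (c * Q).
  split; try exact: nonneg_sumZ.
    by move=> t; rewrite fE mulrBr.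
  by rewrite mulrBr.
have c0' : 0 <= - c by rewrite oppr_ge0 ltW.
exists (fun t => - c * q t), (fun t => - c * p t), (- c * Q), (- c * P).
split; try exact: nonneg_sumZ.
  by move=> t; rewrite fE; ring.
by ring.
Qed.

(** With f = p - q and g = p' - q', the product is the difference of the
    nonnegative families p p' + q q' and p q' + q p'. *)
Lemma has_sum_mul (T1 T2 : choiceType) (f : T1 -> R) (g : T2 -> R)
    (S S' : R) :
  has_sum f S -> has_sum g S' ->
  has_sum (fun k : T1 * T2 => f k.1 * g k.2) (S * S').
Proof.
move=> [p [q [P [Q [pP qQ fE ->]]]]] [p' [q' [P' [Q' [pP' qQ' gE ->]]]]].
exists (fun k => p k.1 * p' k.2 + q k.1 * q' k.2).
exists (fun k => p k.1 * q' k.2 + q k.1 * p' k.2).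
exists (P * P' + Q * Q'), (P * Q' + Q * P'); split.
- by apply: nonneg_sumD; exact: nonneg_sum_prod.
- by apply: nonneg_sumD; exact: nonneg_sum_prod.
- by move=> k; rewrite fE gE; ring.
- by ring.
Qed.

Lemma has_sum_finite_family (I : finType) (T : choiceType) (f : I -> T -> R)
    (S : I -> R) :
  (forall i, has_sum (f i) (S i)) ->
  has_sum (fun k : I * T => f k.1 k.2) (\sum_i S i).
Proof.
move=> fS.
have /choice [p fS1] := fS; have /choice [q fS2] := fS1.
have /choice [P fS3] := fS2; have /choice [Q fS4] := fS3.
exists (fun k => p k.1 k.2), (fun k => q k.1 k.2), (\sum_i P i), (\sum_i Q i).
have nonneg_total (U : choiceType) (r : U -> R) (c : R) :
    nonneg_sum r c -> 0 <= c.
  by case=> r0 rc; rewrite -lee_fin -rc; apply: esum_ge0 => t; rewrite lee_fin.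
split.
- apply: (@nonneg_sum_nested _ _ _ p P); first by move=> i; case: (fS4 i).
  by apply: nonneg_sum_fin => i; apply: (nonneg_total _ (p i)); case: (fS4 i).
- apply: (@nonneg_sum_nested _ _ _ q Q); first by move=> i; case: (fS4 i).
  by apply: nonneg_sum_fin => i; apply: (nonneg_total _ (q i)); case: (fS4 i).
- by move=> k; case: (fS4 k.1).
- by rewrite -sumrB; apply: eq_bigr => i _; case: (fS4 i).
Qed.

Lemma eq_has_sum (T : choiceType) (f g : T -> R) (S : R) :
  f =1 g -> has_sum f S -> has_sum g S.
Proof. by move=> /funext ->. Qed.

Lemma summable_inj (T T' : choiceType) (e : T -> T') (f : T' -> R) :
  injective e -> summable [set: T'] (fun t => (f t)%:E) ->
  summable [set: T] (fun t => (f (e t))%:E).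
Proof.
move=> einj; apply: le_lt_trans.
rewrite -(esum_image [set: T] e (fun t => `|(f t)%:E|)%E); last first.
  by move=> x y _ _; exact: einj.
rewrite esum_mkcond; apply: le_esum => t _.
by case: ifP => // _; rewrite /= lee_fin.
Qed.

(** Induction on d, splitting off the first coordinate: the row vectors of
    length d + 1 are the pairs of an integer and a row vector of length d. *)
Lemma has_sum_row (d : nat) (f : 'I_d -> int -> R) (S : 'I_d -> R) :
  (forall t, has_sum (f t) (S t)) ->
  has_sum (fun r : 'rV[int]_d => \prod_(t < d) f t (r 0 t)) (\prod_(t < d) S t).
Proof.
elim: d f S => [|d IH] f S fS.
  rewrite big_ord0; exists (fun=> 1), (fun=> 0), 1, 0; split.
  - split=> //; rewrite (_ : [set: _] = [set 0]) ?esum_set1 ?lee_fin //.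
    by apply/seteqP; split=> // r _; apply/rowP; case.
  - by split=> //; rewrite esum1.
  - by move=> r; rewrite big_ord0 subr0.
  - by rewrite subr0.
rewrite big_ord_recl.
have := has_sum_mul (fS ord0) (IH _ _ (fun t => fS (lift ord0 t))).
pose e (r : 'rV[int]_d.+1) : int * 'rV[int]_d :=
  (r 0 ord0, \row_t r 0 (lift ord0 t)).
have be : bijective e.
  exists (fun k : int * 'rV[int]_d =>
    \row_t oapp (fun u => k.2 0 u) k.1 (unlift ord0 t)).
    move=> r; apply/rowP => t; rewrite mxE /=.
    by case: unliftP => [j|] -> //=; rewrite mxE.
  move=> [a v]; rewrite /e; congr pair; first by rewrite mxE unlift_none.
  by apply/rowP => t; rewrite !mxE liftK.
move=> /(has_sum_bij be); apply: eq_has_sum => r.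
rewrite big_ord_recl /=; congr (_ * _).
by apply: eq_bigr => t _; rewrite mxE.
Qed.

End SignedSums.

(** * Complex exponentials *)

Section Characters.
Variable R : realType.

Lemma expiD (u v : R) : expi (u + v) = expi u * expi v.
Proof. by rewrite /expi cosD sinD; congr Complex; rewrite // addrC. Qed.

Lemma expi0 : expi (0 : R) = 1.
Proof. by rewrite /expi cos0 sin0. Qed.

Lemma expi_sum (I : Type) (r : seq I) (P : pred I) (F : I -> R) :
  expi (\sum_(i <- r | P i) F i) = \prod_(i <- r | P i) expi (F i).
Proof. exact: (big_morph _ expiD expi0). Qed.

Lemma expiMn (u : R) (k : nat) : expi (u *+ k) = expi u ^+ k.
Proof.
by elim: k => [|k IH]; rewrite ?expi0 ?expr0 // mulrS expiD IH exprS.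
Qed.

Lemma expiN (u : R) : expi (- u) = (expi u)^*.
Proof. by rewrite /expi cosN sinN. Qed.

Lemma expiNK (u : R) : expi u * expi (- u) = 1.
Proof. by rewrite -expiD subrr expi0. Qed.

Lemma expi2pi : expi (2 * pi : R) = 1.
Proof. by rewrite mulr_natl /expi cos2pi sin2pi. Qed.

Lemma expi_int (m : int) : expi (2 * pi * m%:~R : R) = 1.
Proof.
have expi_nat k : expi (2 * pi * k%:R : R) = 1.
  by rewrite mulr_natr expiMn expi2pi expr1n.
case: m => [k|k]; first exact: expi_nat.
rewrite NegzE mulrNz mulrN -[LHS]mul1r -{1}(expi_nat k.+1).
exact: expiNK.
Qed.

(** The real part of expi (2 x) is 1 - 2 sin(x)^2; here x = pi m / n lies
    strictly between 0 and pi when 0 < m < n, so the sine does not vanish.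
    Negative m follow by conjugation. *)
Lemma expi_neq1 (n : nat) (m : int) : m != 0 -> (`|m| < n)%N ->
  expi (2 * pi * (m%:~R / n%:R) : R) != 1.
Proof.
move=> m0 mn.
wlog m_gt0 : m m0 mn / 0 < m.
  move=> H; case: (ltrgt0P m) (m0) => // ms _; first exact: H.
  have : expi (2 * pi * ((- m)%:~R / n%:R) : R) != 1.
    by apply: H; rewrite ?oppr_eq0 ?abszN ?oppr_gt0.
  apply: contra => /eqP e1.
  by rewrite mulrNz mulNr mulrN expiN e1 /= oppr0.
have n0 : (0 < n%:R :> R) by rewrite ltr0n; lia.
have mR : (0 : R) < m%:~R by rewrite ltr0z.
have mnR : (m%:~R : R) < n%:R by rewrite -[n%:R]/(n%:~R) ltr_int; lia.
set x : R := m%:~R / n%:R.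
have x0 : 0 < x by rewrite divr_gt0.
have x1 : x < 1 by rewrite ltr_pdivrMr // mul1r.
have sx : 0 < sin (pi * x).
  by apply: sin_gt0_pi; rewrite mulr_gt0 ?pi_gt0 //= gtr_pMr ?pi_gt0.
apply/negP => /eqP [] c1 _; move: c1.
rewrite (_ : 2 * pi * x = (pi * x) *+ 2); last by rewrite mulr2n; ring.
rewrite cos_mulr2n cos2sin2 => c1.
have : 0 < sin (pi * x) ^+ 2 by rewrite exprn_gt0.
by lra.
Qed.

Lemma geometric_sum_root_of_unity (F : idomainType) (z : F) (n : nat) :
  z ^+ n = 1 -> z != 1 -> \sum_(i < n) z ^+ i = 0.
Proof.
move=> zn z1; have /eqP : (z - 1) * \sum_(i < n) z ^+ i = 0.
  by rewrite -subrX1 zn subrr.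
by rewrite mulf_eq0 subr_eq0 (negPf z1) => /eqP.
Qed.

End Characters.

(** * Residue classes modulo n and the index box *)

Lemma mulrn_int (z : int) (k : nat) : z *+ k = z * k%:Z.
Proof. by rewrite -mulr_natr natz. Qed.

Section Residues.
Variables (d n : nat).
Hypothesis n_gt0 : (0 < n)%N.

Definition box_shift (k : index_box d n * 'rV[int]_d) : 'rV[int]_d :=
  val k.1 + k.2 *+ n.

(** The index box is a complete residue system.  In one coordinate,
    - n <= 2 (k - n r) < n says that r is the quotient of 2 k + n by 2 n. *)
Lemma box_shift_bij : bijective box_shift.
Proof.
pose quot (k : 'rV[int]_d) : 'rV[int]_d :=
  \row_t divz (k 0 t *+ 2 + n%:Z) (n%:Z *+ 2).
have quotP k : k - quot k *+ n \in index_box d n.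
  apply/mem_index_box => t; rewrite !mxE mulmxnE !mxE.
  have := divz_eq (k 0 t *+ 2 + n%:Z) (n%:Z *+ 2).
  have := modz_ge0 (k 0 t *+ 2 + n%:Z) (_ : n%:Z *+ 2 != 0).
  have := ltz_pmod (k 0 t *+ 2 + n%:Z) (_ : 0 < n%:Z *+ 2).
  move: (k 0 t) => z; set a := (_ %/ _)%Z; set b := (_ %% _)%Z.
  rewrite !mulrn_int => h1 h2 h3.
  have {}h1 := h1 ltac:(lia); have {}h2 := h2 ltac:(lia).
  by split; lia.
exists (fun k => ([` quotP k]%fset, quot k)) => [[s r]|k]; last first.
  by rewrite /box_shift /= subrK.
have qE : quot (box_shift (s, r)) = r.
  apply/rowP => t; rewrite /box_shift !mxE mulmxnE /=.
  have /mem_index_box /(_ t) [h1 h2] := valP s.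
  move: h1 h2; move: (val s 0 t) (r 0 t) => z y.
  rewrite !mulrn_int => h1 h2.
  have -> : (z + y * n) * 2%:Z + n = y * (n%:Z * 2) + (z * 2 + n) by lia.
  by rewrite divzMDl ?divz_small ?addr0 //; lia.
congr pair; last exact: qE.
by apply: val_inj; rewrite /= qE /box_shift /= addrK.
Qed.

Lemma has_sum_residues (R : realType) (f : 'rV[int]_d -> R)
    (S : index_box d n -> R) :
  (forall s : index_box d n, has_sum (fun r => f (val s + r *+ n)) (S s)) ->
  has_sum f (\sum_s S s).
Proof.
move=> /has_sum_finite_family fS; have [g gK Kg] := box_shift_bij.
have := has_sum_bij (Bijective Kg gK) fS; apply: eq_has_sum => k /=.
by rewrite -[in RHS](Kg k).
Qed.

Definition standard_residue (f : {ffun 'I_d -> 'I_n}) : 'rV[int]_d :=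
  \row_t (f t : nat)%:Z.

(** Any complete residue system will do for an n-periodic function.  The point
    of {0, ..., n - 1}^d is that it is a set of functions, over which sums of
    products factor. *)
Lemma sum_index_box (V : nmodType) (phi : 'rV[int]_d -> V) :
  (forall k r, phi (k + r *+ n) = phi k) ->
  \sum_(s : index_box d n) phi (val s)
  = \sum_(f : {ffun 'I_d -> 'I_n}) phi (standard_residue f).
Proof.
move=> phiD; have [g gK Kg] := box_shift_bij.
(* The bijection sends an element of the standard system to the box
   representative of its class. *)
rewrite (reindex (fun f => (g (standard_residue f)).1)) /=.
  apply: eq_bigr => f _; rewrite -[in RHS](Kg (standard_residue f)) /box_shift.
  by rewrite phiD.
apply: onW_bij.
have mod_lt (z : int) : (`|modz z n| < n)%N.
  have := ltz_pmod z (_ : 0 < n%:Z); have := modz_ge0 z (_ : n%:Z != 0).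
  move=> h1 h2; have {}h1 := h1 ltac:(lia); have {}h2 := h2 ltac:(lia); lia.
pose mod_n (s : 'rV[int]_d) : {ffun 'I_d -> 'I_n} :=
  [ffun t => Ordinal (mod_lt (s 0 t))].
exists (fun s => mod_n (val s)).
  move=> f; apply/ffunP => t; apply: val_inj; rewrite !ffunE /=.
  have := congr1 (fun v : 'rV_d => v 0 t) (Kg (standard_residue f)).
  rewrite /box_shift !mxE mulmxnE mulrn_int => e.
  have -> : val (g (standard_residue f)).1 0 t
      = (- (g (standard_residue f)).2 0 t) * n%:Z + (f t : nat)%:Z.
    by rewrite -e; ring.
  by rewrite modzMDl modz_small // ltz_nat ltn_ord.
move=> s; set r := \row_t divz (val s 0 t) n%:Z.
have -> : standard_residue (mod_n (val s)) = box_shift (s, - r).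
  apply/rowP => t; rewrite /box_shift !mxE mulmxnE !mxE ffunE /=.
  rewrite mulrn_int gez0_abs ?modz_ge0 //; last by lia.
  by have := divz_eq (val s 0 t) n; lia.
by rewrite gK.
Qed.

(** * The kernel on the grid *)

Section PointwiseEvaluation.
Variable R : realType.

(** Changing the frequency by n r changes the phase at the point m / n by the
    integer r . m. *)
Lemma grid_character_shift (s r m : 'rV[int]_d) :
  expi (2 * pi * idot (s + r *+ n) (grid_point R n m))
  = expi (2 * pi * idot s (grid_point R n m)).
Proof.
have -> : idot (s + r *+ n) (grid_point R n m)
  = idot s (grid_point R n m) + (\sum_t r 0 t * m 0 t)%:~R.
  rewrite /idot rmorph_sum -big_split /=; apply: eq_bigr => t _.
  rewrite !mxE mulmxnE intrD rmorphMn rmorphM /= mulrDl; congr (_ + _).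
  by rewrite -mulr_natr; field; rewrite pnatr_eq0; lia.
by rewrite mulrDr expiD expi_int mulr1.
Qed.

(** Orthogonality of characters.  After passing to {0, ..., n - 1}^d the sum is
    a product over t of geometric sums of the n-th root of unity
    expi (2 pi m_t / n), which differs from 1 when 0 < |m_t| < n. *)
Lemma index_box_orthogonality (m : 'rV[int]_d) :
  (forall t, (`|m 0%R t| < n)%N) ->
  \sum_(s : index_box d n) expi (2 * pi * idot (val s) (grid_point R n m))
  = ((n ^ d)%:R *+ (m == 0) : R[i]).
Proof.
move=> mn.
rewrite (sum_index_box
  (phi := fun k => expi (2 * pi * idot k (grid_point R n m)))); last first.
  by move=> k r; exact: grid_character_shift.
pose z t : R[i] := expi (2 * pi * ((m 0 t)%:~R / n%:R)).
transitivity (\sum_(f : {ffun 'I_d -> 'I_n}) \prod_t z t ^+ f t).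
  apply: eq_bigr => f _; rewrite /idot mulr_sumr expi_sum.
  apply: eq_bigr => t _; rewrite -expiMn !mxE; congr expi.
  by rewrite -[LHS]/(2 * pi * ((f t : nat)%:R * _)) -mulr_natr; ring.
rewrite -(bigA_distr_bigA (fun t (i : 'I_n) => z t ^+ i)) /=.
case: eqP => [m0|/eqP m0].
  rewrite mulr1n natrX -[in RHS](card_ord d) -prodr_const.
  apply: eq_bigr => t _.
  rewrite (eq_bigr (fun=> 1)) ?sumr_const ?card_ord // => i _.
  by rewrite /z m0 mxE mul0r mulr0 expi0 expr1n.
have [t mt] : exists t, m 0 t != 0.
  apply/existsP; apply: contraR m0 => /existsPn m0.
  by apply/eqP/rowP => t; rewrite mxE; apply/eqP; have := m0 t; rewrite negbK.
rewrite (bigD1 t) //= geometric_sum_root_of_unity ?mul0r //.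
  rewrite /z -expiMn -[RHS](expi_int R (m 0 t)); congr expi.
  by rewrite -mulr_natr; field; rewrite pnatr_eq0; lia.
exact: expi_neq1.
Qed.

Lemma sum_Complex (I : finType) (a b : I -> R) :
  (\sum_i a i) +i* (\sum_i b i) = \sum_i (a i +i* b i).
Proof. by elim/big_rec3: _ => // i x y z _ <-. Qed.

(** Aliasing: by [grid_character_shift], all terms of a class carry the same
    phase at a grid point, which factors out of the sum over that class. *)
Lemma kernel_grid (w : 'rV[int]_d -> R) (m : 'rV[int]_d) :
  summable [set: 'rV[int]_d] (fun k => (w k)%:E) ->
  Defs.kernel w (grid_point R n m)
  = \sum_(s : index_box d n) (rsum (fun r => w (val s + r *+ n)))%:C
      * expi (2 * pi * idot (val s) (grid_point R n m)).
Proof.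
move=> wS.
have classS (s : index_box d n) :
    has_sum (fun r => w (val s + r *+ n)) (rsum (fun r => w (val s + r *+ n))).
  apply/summable_has_sum/(summable_inj (e := fun r => val s + r *+ n)) => //.
  move=> r r' /addrI e; apply/rowP => t.
  have := congr1 (fun v : 'rV_d => v 0 t) e.
  by rewrite !mulmxnE !mulrn_int => /mulIf; apply; lia.
(* The real and imaginary parts are treated at once: c is either of them. *)
have trig (c : R[i] -> R) :
  has_sum (fun k => w k * c (expi (2 * pi * idot k (grid_point R n m))))
   (\sum_(s : index_box d n) rsum (fun r => w (val s + r *+ n))
      * c (expi (2 * pi * idot (val s) (grid_point R n m)))).
  apply: has_sum_residues => s; rewrite [X in has_sum _ X]mulrC.
  apply: eq_has_sum (has_sumZ _ (classS s)) => r.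
  by rewrite grid_character_shift mulrC.
rewrite /Defs.kernel /csum.
under eq_fun => k do rewrite /= mul0r subr0.
under [X in _ +i* rsum X]eq_fun => k do rewrite /= mul0r addr0.
have := has_sum_rsum (trig (@complex.Re R)); rewrite /= => ->.
have := has_sum_rsum (trig (@complex.Im R)); rewrite /= => ->.
rewrite sum_Complex; apply: eq_bigr => s _.
by rewrite /expi; congr Complex; ring.
Qed.

End PointwiseEvaluation.
End Residues.

(** * Spectra of diagonal and similar matrices *)

Section DiagonalSpectra.
Variable F : fieldType.

(** Induction on the size, peeling off the first diagonal entry as a block. *)
Lemma mxrank_diag (m : nat) (v : 'rV[F]_m) :
  \rank (diag_mx v) = count (predC (pred1 0)) [seq v 0 i | i <- enum 'I_m].
Proof.
elim: m v => [|m IH] v; first by rewrite thinmx0 mxrank0 enum_ord0.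
rewrite enum_ordSl /= -map_comp.
set a : 'rV_1 := (v 0 ord0)%:M; set b : 'rV_m := \row_i v 0 (lift ord0 i).
have vE : v = row_mx a b :> 'rV_(1 + m).
  apply/rowP => i; rewrite mxE; case: splitP => j ij.
    rewrite ord1 mxE eqxx mulr1n; congr (v _ _); apply: val_inj.
    by rewrite /= ij ord1.
  by rewrite mxE; congr (v _ _); apply: val_inj.
transitivity (\rank (diag_mx (row_mx a b))); first by rewrite -vE.
rewrite diag_mx_row rank_diag_block_mx IH; congr (_ + _)%N.
  rewrite rank_rV (_ : diag_mx a = (v 0 ord0)%:M); last first.
    by apply/matrixP => i j; rewrite !mxE !ord1 eqxx !mulr1n.
  by rewrite -scalemx1 scaler_eq0 oner_eq0 orbF.
by congr count; apply: eq_map => i; rewrite mxE.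
Qed.

Lemma eigenvalues_listed_diag (m : nat) (v : 'rV[F]_m) :
  eigenvalues_listed (diag_mx v) [seq v 0 i | i <- enum 'I_m].
Proof.
split.
  rewrite char_poly_trig ?diag_mx_is_trig // big_map big_enum.
  by apply: eq_bigr => i _; rewrite mxE eqxx mulr1n.
move=> a; rewrite /eigenspace mxrank_ker.
have -> : diag_mx v - a%:M = diag_mx (v - const_mx a).
  by rewrite raddfB /= diag_const_mx.
have -> : \rank (diag_mx (v - const_mx a))
    = count (predC (pred1 a)) [seq v 0 i | i <- enum 'I_m].
  rewrite mxrank_diag !count_map; apply: eq_count => i.
  by rewrite /= !mxE subr_eq0.
have := count_predC (pred1 a) [seq v 0 i | i <- enum 'I_m].
by rewrite size_map size_enum_ord => {1}<-; rewrite addnK.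
Qed.

Lemma eigenvalues_listed_similar (m : nat) (P A B : 'M[F]_m) (l : seq F) :
  P \in unitmx -> P *m A = B *m P ->
  eigenvalues_listed B l -> eigenvalues_listed A l.
Proof.
move=> Pu PA [Bchar Beig]; split.
  rewrite -Bchar; apply: (@mulfI _ (\det (map_mx polyC P))).
    by rewrite det_map_mx polyC_eq0 -unitfE -unitmxE.
  rewrite [RHS]mulrC /char_poly -!det_mulmx /char_poly_mx.
  by rewrite mulmxBr mulmxBl -!map_mxM PA scalar_mxC.
move=> a; rewrite -Beig /eigenspace !mxrank_ker.
have PAa : P *m (A - a%:M) = (B - a%:M) *m P.
  by rewrite mulmxBr mulmxBl PA scalar_mxC.
have Pfull : row_full P by rewrite row_full_unit.
have Pfree : row_free P by rewrite row_free_unit.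
by rewrite -(eqmxMfull (A - a%:M) Pfull) PAa mxrankMfree.
Qed.

Lemma eigenvalues_listed_perm (m : nat) (A : 'M[F]_m) (l l' : seq F) :
  perm_eq l l' -> eigenvalues_listed A l -> eigenvalues_listed A l'.
Proof.
move=> ll' [charA eigA]; split; first by rewrite charA; exact: perm_big.
by move=> a; rewrite eigA; apply/permP.
Qed.

End DiagonalSpectra.

(** * Extremal eigenvalues of matrices with real spectrum *)

Section ExtremalEigenvalues.
Variable R : realType.

Lemma seq_min (l : seq R) : l != [::] ->
  exists2 a, a \in l & forall b, b \in l -> a <= b.
Proof.
elim: l => // x l IH _; case: l IH => [_|y l /(_ isT) [a al amin]].
  by exists x; rewrite ?mem_head // => b; rewrite inE => /eqP ->.
case: (leP a x) => ax.
  exists a; rewrite ?inE in al *; first by rewrite al orbT.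
  by move=> b; rewrite in_cons => /predU1P [-> //|/amin].
exists x; rewrite ?mem_head // => b; rewrite in_cons => /predU1P [-> //|/amin].
exact: le_trans (ltW ax).
Qed.

(** The eigenvalues are the roots of the characteristic polynomial, which has
    positive degree and splits over R[i]. *)
Lemma extremal_eigenvalues_exist (m : nat) (A : 'M[R[i]]_m) :
  (0 < m)%N -> (forall z, eigenvalue A z -> z = (complex.Re z)%:C) ->
  exists a b, smallest_eigenvalue A a /\ largest_eigenvalue A b.
Proof.
move=> m0 Areal.
have [l lE] := closed_field_poly_normal (char_poly A).
rewrite (monicP (char_poly_monic A)) scale1r in lE.
have memE z : eigenvalue A z = (z \in l).
  by rewrite eigenvalue_root_char lE root_prod_XsubC.
have Re_mem z : eigenvalue A z -> complex.Re z \in map (@complex.Re R) l.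
  by rewrite memE; apply: map_f.
have Re_eig x : x \in map (@complex.Re R) l -> eigenvalue A x%:C.
  by case/mapP => z; rewrite -memE => zA ->; rewrite -Areal.
have l0 : l != [::].
  apply/eqP => l_nil; have := size_char_poly A.
  by rewrite lE l_nil big_nil size_poly1; lia.
have [a al amin] : exists2 a, a \in map (@complex.Re R) l
    & forall b, b \in map (@complex.Re R) l -> a <= b.
  by apply: seq_min; case: (l) l0.
have [b bl bmin] : exists2 b, b \in map -%R (map (@complex.Re R) l)
    & forall c, c \in map -%R (map (@complex.Re R) l) -> b <= c.
  by apply: seq_min; case: (l) l0.
case/mapP: bl bmin => b' b'l -> bmin.
exists a, b'; split; split; try exact: Re_eig.
  by move=> z zA; rewrite (Areal z zA) lecR; apply/amin/Re_mem.
by move=> z zA; rewrite (Areal z zA) lecR -lerN2; apply/bmin/map_f/Re_mem.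
Qed.

End ExtremalEigenvalues.

(** * Fourier factorization of the kernel matrices *)

Section FourierFactorization.
Variables (R : realType) (d n : nat).
Hypothesis n_gt0 : (0 < n)%N.
Implicit Types G : {fset 'rV[int]_d}.

Definition adjoint (p q : nat) (A : 'M[R[i]]_(p, q)) : 'M[R[i]]_(q, p) :=
  (map_mx conjc A)^T.

Lemma adjointM (p q r : nat) (A : 'M[R[i]]_(p, q)) (B : 'M[R[i]]_(q, r)) :
  adjoint (A *m B) = adjoint B *m adjoint A.
Proof. by rewrite /adjoint map_mxM trmx_mul. Qed.

Definition sqmod (x : R[i]) : R := complex.Re x ^+ 2 + complex.Im x ^+ 2.

Lemma sqmod_ge0 (x : R[i]) : 0 <= sqmod x.
Proof. by rewrite addr_ge0 ?sqr_ge0. Qed.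

Lemma mul_conjc (x : R[i]) : x * conjc x = (sqmod x)%:C.
Proof. by case: x => a b; rewrite /sqmod; congr Complex => /=; ring. Qed.

Lemma diag_form (m : nat) (v : 'rV[R[i]]_m) (c : 'I_m -> R) :
  v *m diag_mx (\row_i (c i)%:C) *m adjoint v
  = (\sum_i c i * sqmod (v 0 i))%:C%:M.
Proof.
apply/rowP => k; rewrite ord1 [LHS]mxE [RHS]mxE eqxx mulr1n rmorph_sum /=.
apply: eq_bigr => i _.
by rewrite mul_mx_diag !mxE rmorphM /= -mul_conjc; ring.
Qed.

Lemma sqnorm_form (m : nat) (v : 'rV[R[i]]_m) :
  v *m adjoint v = (\sum_i sqmod (v 0 i))%:C%:M.
Proof.
have -> : \sum_i sqmod (v 0 i) = \sum_i 1 * sqmod (v 0 i).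
  by apply: eq_bigr => i _; rewrite mul1r.
rewrite -diag_form (_ : diag_mx _ = 1%:M) ?mulmx1 //.
by apply/matrixP => i j; rewrite !mxE.
Qed.

Lemma sqnorm_gt0 (m : nat) (v : 'rV[R[i]]_m) :
  v != 0 -> 0 < \sum_i sqmod (v 0 i).
Proof.
move=> v0; have [i vi] : exists i, v 0 i != 0.
  apply/existsP; apply: contraR v0 => /existsPn v0.
  by apply/eqP/rowP => i; rewrite mxE; apply/eqP; have := v0 i; rewrite negbK.
rewrite (bigD1 i) //= ltr_pwDl //; last first.
  by apply: sumr_ge0 => j _; exact: sqmod_ge0.
rewrite lt_def sqmod_ge0 andbT /sqmod paddr_eq0 ?sqr_ge0 // !sqrf_eq0.
by apply: contra vi; rewrite eq_complex.
Qed.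

Definition fourier_mx G : 'M[R[i]]_(#|{: G}|, #|{: index_box d n}|) :=
  \matrix_(p, s)
    expi (2 * pi * idot (val (enum_val s)) (grid_point R n (val (enum_val p)))).

Lemma grid_character (s j l : 'rV[int]_d) :
  expi (2 * pi * idot s (grid_point R n (j - l)))
  = expi (2 * pi * idot s (grid_point R n j))
    * conjc (expi (2 * pi * idot s (grid_point R n l))).
Proof.
rewrite -expiN -expiD -mulrN -mulrDr /idot -sumrN -big_split.
congr (expi (_ * _)); apply: eq_bigr => t _.
by rewrite !mxE rmorphB /= mulrBl mulrBr.
Qed.

Lemma fourier_mx_rows_orthogonal G : (G `<=` index_box d n)%fset ->
  fourier_mx G *m adjoint (fourier_mx G) = ((n ^ d)%:R)%:M.
Proof.
move=> GI; apply/matrixP => p q; rewrite !mxE.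
set j := val (enum_val p); set l := val (enum_val q).
transitivity (\sum_(s : index_box d n)
    expi (2 * pi * idot (val s) (grid_point R n (j - l)))).
  rewrite [RHS](reindex _ (onW_bij _ (enum_val_bij _))) /=.
  by apply: eq_bigr => s _; rewrite grid_character !mxE.
rewrite index_box_orthogonality //; last first.
  move=> t; rewrite !mxE.
  have /mem_index_box /(_ t) := fsubsetP GI _ (valP (enum_val p)).
  have /mem_index_box /(_ t) := fsubsetP GI _ (valP (enum_val q)).
  rewrite -/j -/l; move: (j 0 t) (l 0 t) => x y.
  by rewrite !mulrn_int => -[? ?] [? ?]; lia.
rewrite subr_eq0; congr (_ *+ nat_of_bool _); apply/eqP/eqP => [jl|pq].
  by apply: enum_val_inj; apply: val_inj.
by rewrite /j pq.
Qed.

Variable w : 'rV[int]_d -> R.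
Hypothesis wS : summable [set: 'rV[int]_d] (fun k => (w k)%:E).

Definition aliased_weight (s : 'rV[int]_d) : R :=
  rsum (fun r : 'rV[int]_d => w (s + r *+ n)).

(** The factor c allows for both D, in the factorization, and n^d D, to which
    the full kernel matrix is similar. *)
Definition aliased_diag (c : R) : 'M[R[i]]_(#|{: index_box d n}|) :=
  diag_mx (\row_s (c * aliased_weight (val (enum_val s)))%:C).

(** By [grid_character], each term of the finite sum in [kernel_grid] splits
    into a factor for the row and a conjugate factor for the column. *)
Lemma kernel_mx_factorization G :
  kernel_mx n w G
  = fourier_mx G *m aliased_diag 1 *m adjoint (fourier_mx G).
Proof.
apply/matrixP => p q; rewrite mxE kernel_grid // [RHS]mxE.
rewrite [LHS](reindex _ (onW_bij _ (enum_val_bij _))) /=.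
apply: eq_bigr => s _; rewrite grid_character mul_mx_diag !mxE mul1r.
by rewrite /aliased_weight; ring.
Qed.

(** With F F^* = n^d I and F square, also F^* F = n^d I, so that
    F^* F D F^* = (n^d D) F^*: conjugation by F^* diagonalizes. *)
Lemma kernel_mx_eigenvalues :
  eigenvalues_listed (kernel_mx n w (index_box d n))
    [seq ((n ^ d)%:R * aliased_weight s)%:C | s <- index_box d n].
Proof.
set F := fourier_mx (index_box d n).
have nd0 : (n ^ d)%:R != 0 :> R[i] by rewrite pnatr_eq0 expn_eq0; lia.
have FFa : F *m adjoint F = ((n ^ d)%:R)%:M.
  exact/fourier_mx_rows_orthogonal/fsubset_refl.
have F_inv : F *m ((n ^ d)%:R^-1 *: adjoint F) = 1%:M.
  by rewrite -scalemxAr FFa scale_scalar_mx mulVf.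
have FaF : adjoint F *m F = ((n ^ d)%:R)%:M.
  have := mulmx1C F_inv.
  rewrite -scalemxAl => /(congr1 (fun M => (n ^ d)%:R *: M)).
  by rewrite scalerA mulfV // scale1r scalemx1.
have Fa_unit : adjoint F \in unitmx.
  by case/mulmx1_unit: F_inv => _; rewrite unitmxZ // unitfE invr_eq0.
apply: (eigenvalues_listed_perm _
  (eigenvalues_listed_similar Fa_unit (B := aliased_diag (n ^ d)%:R) _
    (eigenvalues_listed_diag _))).
  pose lambda (s : index_box d n) := ((n ^ d)%:R * aliased_weight (val s))%:C.
  have -> : [seq ((n ^ d)%:R * aliased_weight s)%:C | s <- index_box d n]
      = [seq lambda s | s <- enum {: index_box d n}].
    by rewrite enum_fsetE -map_comp.
  rewrite (eq_map (g := lambda \o enum_val)); last by move=> i; rewrite /= mxE.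
  rewrite map_comp; apply: (perm_map lambda); apply: uniq_perm.
  - by rewrite map_inj_uniq ?enum_uniq //; exact: enum_val_inj.
  - exact: enum_uniq.
  - move=> s; rewrite mem_enum; apply/mapP; exists (enum_rank s).
      by rewrite mem_enum.
    by rewrite enum_rankK.
rewrite kernel_mx_factorization !mulmxA FaF; congr (_ *m _).
rewrite mul_scalar_mx; apply/matrixP => s s'; rewrite !mxE.
by rewrite !rmorphM /= mul1r rmorph_nat mulrnAr.
Qed.

(** For an eigenvector v with eigenvalue z, and u = v F, the factorization
    gives z |v|^2 = sum_s mu_s |u_s|^2, and orthogonality of the rows of F gives
    |u|^2 = n^d |v|^2.  So z is a weighted average of the n^d mu_s. *)
Lemma kernel_mx_eigenvalue_bounds G (a b : R) (z : R[i]) :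
  (G `<=` index_box d n)%fset ->
  (forall s, s \in index_box d n -> a <= (n ^ d)%:R * aliased_weight s <= b) ->
  eigenvalue (kernel_mx n w G) z -> a%:C <= z <= b%:C.
Proof.
move=> GI ab /eigenvalueP [v vz v0].
have nd0 : (0 : R) < (n ^ d)%:R by rewrite ltr0n expn_gt0 n_gt0.
pose u := v *m fourier_mx G.
have uE : adjoint u = adjoint (fourier_mx G) *m adjoint v by exact: adjointM.
pose V := \sum_i sqmod (v 0 i); have V0 : 0 < V by exact: sqnorm_gt0.
pose mu (s : 'I_#|{: index_box d n}|) := aliased_weight (val (enum_val s)).
have uV : \sum_s sqmod (u 0 s) = (n ^ d)%:R * V.
  have := sqnorm_form u.
  rewrite uE /u mulmxA -(mulmxA v) fourier_mx_rows_orthogonal //.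
  rewrite mul_mx_scalar -scalemxAl sqnorm_form scale_scalar_mx.
  move/(congr1 (fun M : 'M[R[i]]_1 => M 0 0)); rewrite !mxE eqxx !mulr1n.
  by rewrite -(rmorph_nat (real_complex R)) -rmorphM => /complexI.
have zV : z * V%:C = (\sum_s mu s * sqmod (u 0 s))%:C.
  have := diag_form u mu.
  rewrite uE /u mulmxA.
  have -> : diag_mx (\row_i (mu i)%:C) = aliased_diag 1.
    by apply/matrixP => s s'; rewrite !mxE mul1r.
  rewrite -(mulmxA v) -(mulmxA v) -kernel_mx_factorization vz.
  rewrite -scalemxAl sqnorm_form scale_scalar_mx.
  by move/(congr1 (fun M : 'M[R[i]]_1 => M 0 0)); rewrite !mxE eqxx !mulr1n.
have -> : z = ((\sum_s mu s * sqmod (u 0 s)) / V)%:C.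
  by rewrite rmorphM fmorphV /= -zV mulfK // fmorph_eq0 gt_eqF.
have mu_ab s : a <= (n ^ d)%:R * mu s <= b by apply: ab; exact: valP.
rewrite !lecR ler_pdivlMr // ler_pdivrMr //.
apply/andP; split; rewrite -(ler_pM2l nd0) mulrCA -uV !mulr_sumr;
  apply: ler_sum => s _; rewrite mulrA ler_wpM2r ?sqmod_ge0 //;
  by case/andP: (mu_ab s).
Qed.

End FourierFactorization.

(** * Spectra of the kernel matrices *)

Unset Implicit Arguments.
Set Strict Implicit.
Set Printing Implicit Defensive.

Theorem theorem4p10 (R : realType) (d n : nat) (hd : (0 < d)%N) (hn : (0 < n)%N)
    (w : 'rV[int]_d -> R)
    (hw : summable [set: 'rV[int]_d] (fun k => (w k)%:E)) :
  (* (i) *)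
  eigenvalues_listed (kernel_mx n w (index_box d n))
    [seq ((n ^ d)%:R * rsum (fun r : 'rV[int]_d => w (s + r *+ n)))%:C
       | s <- index_box d n]
  /\
  (* (ii) *)
  (forall w1 : int -> R,
     summable [set: int] (fun k => (w1 k)%:E) ->
     (forall k : 'rV[int]_d, w k = \prod_(t < d) w1 (k 0 t)) ->
     (forall s : 'rV[int]_d, s \in index_box d n ->
        (n ^ d)%:R * rsum (fun r : 'rV[int]_d => w (s + r *+ n))
        = (n ^ d)%:R
          * \prod_(t < d) rsum (fun r : int => w1 (s 0 t + n%:Z * r)))
     /\
     eigenvalues_listed (kernel_mx n w (index_box d n))
       [seq ((n ^ d)%:R
             * \prod_(t < d) rsum (fun r : int => w1 (s 0 t + n%:Z * r)))%:C
          | s : 'rV[int]_d <- index_box d n])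
  /\
  (* (iii) *)
  (forall G : {fset 'rV[int]_d},
     (G `<=` index_box d n)%fset -> G != fset0 ->
     exists a b aG bG : R,
       smallest_eigenvalue (kernel_mx n w (index_box d n)) a
       /\ largest_eigenvalue (kernel_mx n w (index_box d n)) b
       /\ smallest_eigenvalue (kernel_mx n w G) aG
       /\ largest_eigenvalue (kernel_mx n w G) bG
       /\ a <= aG /\ bG <= b).
Proof.
have eigs := kernel_mx_eigenvalues hn hw.
split; [exact: eigs|split=> [w1 w1S wE|G GI G0]].
  have aliasE (s : 'rV[int]_d) :
      rsum (fun r : 'rV[int]_d => w (s + r *+ n))
      = \prod_(t < d) rsum (fun r : int => w1 (s 0 t + n%:Z * r)).
    apply: has_sum_rsum.
    apply: (@eq_has_sum _ _
      (fun r : 'rV[int]_d => \prod_(t < d) w1 (s 0 t + n%:Z * r 0 t))).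
      move=> r; rewrite wE; apply: eq_bigr => t _.
      by rewrite mxE mulmxnE mulrn_int mulrC.
    apply: (has_sum_row (f := fun t r => w1 (s 0 t + n%:Z * r))) => t.
    apply/summable_has_sum.
    apply: (summable_inj (e := fun r => s 0 t + n%:Z * r)) => //.
    by move=> r r' /addrI /mulfI; apply; lia.
  split=> [s _|]; first by rewrite aliasE.
  under eq_map => s do rewrite -aliasE.
  exact: eigs.
have nonempty (H : {fset 'rV[int]_d}) : (G `<=` H)%fset -> (0 < #|{: H}|)%N.
  by move=> GH; rewrite -cardfE (leq_trans _ (fsubset_leq_card GH)) ?cardfs_gt0.
set box_eigs := [seq _ | s <- _] in eigs.
have mem_eigs z :
    eigenvalue (kernel_mx n w (index_box d n)) z = (z \in box_eigs).
  by rewrite eigenvalue_root_char (proj1 eigs) root_prod_XsubC.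
have [z|a [b [aE bE]]] := extremal_eigenvalues_exist (nonempty _ GI)
    (A := kernel_mx n w (index_box d n)).
  by rewrite mem_eigs => /mapP [s _ ->].
(* The numbers n^d mu_s are eigenvalues over the box, hence between a and b,
   and so are their weighted averages. *)
have bounds z : eigenvalue (kernel_mx n w G) z -> a%:C <= z <= b%:C.
  apply: kernel_mx_eigenvalue_bounds => // s sI.
  have lamE : eigenvalue (kernel_mx n w (index_box d n))
      ((n ^ d)%:R * aliased_weight n w s)%:C.
    by rewrite mem_eigs; apply: map_f.
  by rewrite -!lecR (proj2 aE) ?(proj2 bE).
have [z|aG [bG [aGE bGE]]] := extremal_eigenvalues_exist
    (nonempty _ (fsubset_refl G)) (A := kernel_mx n w G).
  by case: z => x y /bounds; rewrite lecE /= => /andP [/andP [/eqP -> _] _].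
exists a, b, aG, bG; do 4!split => //.
split.
  by have /andP [] := bounds _ (proj1 aGE); rewrite lecR.
by have /andP [] := bounds _ (proj1 bGE); rewrite !lecR.
Qed.
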